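(* The alternating group $A_6$ is wexp-solvable.
   Context: Let $G$ be a finite group. A subgroup $H \le G$ is called weakly exponential with respect to $G$ if, for all $x \in G$, there exists $g \in G$ such that $x^{|G:H|} \in H^g$, where $H^g = g^{-1}Hg$. The group $G$ is called wexp-solvable if every subgroup of $G$ is weakly exponential with respect to $G$. *)

(* Defs.v *)
From mathcomp Require Import all_boot all_fingroup all_solvable.

Set Implicit Arguments.
Unset Strict Implicit.
Unset Printing Implicit Defensive.

Local Open Scope group_scope.

(* Meant for H \subset G only: for other H, #|G : H| is the index of G :&: H. *)
Definition weakly_exponential (gT : finGroupType) (G H : {group gT}) : Prop :=
  forall x : gT, x \in G ->
    exists2 g : gT, g \in G & x ^+ #|G : H| \in H :^ g.

Definition wexp_solvable (gT : finGroupType) (G : {group gT}) : Prop :=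
  forall H : {group gT}, H \subset G -> weakly_exponential G H.

(* Main.v *)
Require Import Defs.
From mathcomp Require Import all_boot all_fingroup all_solvable.
From mathcomp Require Import zify.

Set Implicit Arguments.
Unset Strict Implicit.
Unset Printing Implicit Defensive.

(** Every element of [A_6] has order 1, 2, 3, 4 or 5, and all its involutions
are conjugate; the theorem follows from these two facts and Sylow's theorems.
Let [n] be the index of [H] and let [x] be an element of order a power of a
prime [p]. If [p] does not divide [n], then [H] contains a Sylow [p]-subgroup
of the whole group, so some conjugate of [H] contains [x], hence its powers
([p_elt_conj_subgroup]). If the order of [x] divides [n], then [x ^+ n = 1].
When [x] has order 1 or a prime order, one of the two cases applies. In the
remaining case [x] has order 4 and [n] is 2 modulo 4; then [x ^+ n] is an
involution, [H] has even order because 4 divides 360, so [H] contains an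
involution too, and the two are conjugate.

The bound on the orders ([Alt6_order_le5]) is a statement about cycle types: a
permutation of six points is even exactly when its number of cycles is even,
and the only partitions of 6 whose least common multiple exceeds 5 are [6] and
[1 + 2 + 3], with an odd number of parts. The conjugacy of involutions
([Alt6_involutions_conj]) holds because they are all of the form [(a b)(c d)],
and the alternating group is 4-transitive on six points. *)

Local Open Scope group_scope.

(** * Orders of elements *)

Lemma partition_porbits (T : finType) (s : {perm T}) :
  partition (porbits s) [set: T].
Proof.
have -> : porbits s = orbit 'P <[s]> @: [set: T].
  rewrite /porbits; apply/setP=> B.
  by apply/imsetP/imsetP=> -[t _ ->]; exists t; rewrite ?porbitE.
by apply: orbit_partition; apply/actsP=> a _ t; rewrite !inE.
Qed.

(** The power of [s] by the length of the cycle through [t] fixes [t], so any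
common multiple of the cycle lengths kills [s]. *)
Lemma order_dvdn_porbits (T : finType) (s : {perm T}) (k : nat) :
  (forall B, B \in porbits s -> #|B| %| k) -> #[s] %| k.
Proof.
move=> dvd_k; rewrite order_dvdn; apply/eqP/permP=> t; rewrite perm1.
have /dvdnP[q ->] : #|porbit s t| %| k by apply/dvd_k/imset_f.
elim: q => [|q IHq]; first by rewrite mul0n expg0 perm1.
by rewrite mulSn expgD permM [X in (s ^+ (q * _)) X]permX iter_porbit.
Qed.

(** The lengths are those of the cycles of an even permutation of six points.
With two parts the compositions are 1 + 5, 2 + 4 and 3 + 3 up to order; with
four parts, 1 + 1 + 1 + 3 and 1 + 1 + 2 + 2; with six parts, all parts are 1. *)
Lemma even_composition6_common_multiple (r : seq nat) :
    sumn r = 6 -> all (leq 1) r -> ~~ odd (size r) ->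
  exists2 k, 0 < k <= 5 & all (dvdn^~ k) r.
Proof.
case: r => [|a [|b [|c [|d [|e [|f [|g r]]]]]]] //=.
- rewrite addn0 andbT => ab /andP[a0 b0] _.
  have : a < 6 by lia.
  have -> : b = 6 - a by lia.
  case: a a0 {b b0 ab} => [|[|[|[|[|[|a]]]]]] // _ _;
    by [exists 5 | exists 4 | exists 3].
- rewrite addn0 andbT => abcd /and4P[a0 b0 c0 d0] _.
  have [a4 b4 c4 d4] : [/\ a < 4, b < 4, c < 4 & d < 4] by split; lia.
  move: a b c d a0 b0 c0 d0 a4 b4 c4 d4 abcd.
  do 4!case=> [|[|[|[|//]]]] //; by [exists 2 | exists 3].
- move=> sum6 /and5P[a0 b0 c0 d0 /and3P[e0 f0 _]] _.
  have [-> -> -> [-> -> ->]] :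
      [/\ a = 1, b = 1, c = 1 & [/\ d = 1, e = 1 & f = 1]]%N.
    by split; [| | |split]; lia.
  by exists 1%N.
- lia.
Qed.

Lemma Alt6_order_le5 (T : finType) (x : {perm T}) :
  #|T| = 6 -> x \in 'Alt_T -> #[x] <= 5.
Proof.
move=> T6; rewrite Alt_even /odd_perm T6 /= => evx.
pose r := [seq #|B| | B : {set T} in porbits x].
have [|||k /andP[k_gt0 k5] /allP dvd_k] := @even_composition6_common_multiple r.
- rewrite sumnE big_map big_enum /= -(card_partition (partition_porbits x)).
  by rewrite cardsT.
- apply/allP=> _ /mapP[B xB ->]; move: xB; rewrite mem_enum => /imsetP[t _ ->].
  by rewrite card_gt0; apply/set0Pn; exists t; apply: porbit_id.
- by rewrite size_map -cardE.
apply: leq_trans k5; apply/dvdn_leq/order_dvdn_porbits => // B xB.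
by apply/dvd_k/map_f; rewrite mem_enum.
Qed.

(** * Conjugacy of involutions *)

(** If [y] moved a point [e], then [e] and [y e] would be the two points
outside [a, b, c, d], and [y] would be the odd permutation [(e (y e))]. *)
Lemma Alt6_fix4_eq1 (T : finType) (y : {perm T}) (a b c d : T) :
    #|T| = 6 -> y \in 'Alt_T -> uniq [:: a; b; c; d] ->
  y a = a -> y b = b -> y c = c -> y d = d -> y = 1.
Proof.
move=> T6; rewrite Alt_even => evy abcd ya yb yc yd.
have fixed z : z \in [:: a; b; c; d] -> y z = z.
  by rewrite !inE => /or4P[] /eqP->.
apply/permP=> e; rewrite perm1; apply/eqP/idPn=> ye.
have nfix z : y z != z -> z \notin [:: a; b; c; d].
  by apply: contra => /fixed->.
have yye : y (y e) != y e by rewrite (inj_eq perm_inj).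
have T_eq : [:: y e, e, a, b, c & [:: d]] =i predT.
  apply/subset_cardP; last exact/subset_predT.
  rewrite -[RHS]/(#|T|) T6; apply/card_uniqP.
  by rewrite 2!cons_uniq abcd inE negb_or ye !nfix.
case/negP: evy; rewrite (_ : y = tperm e (y e)) ?odd_tperm 1?eq_sym //.
apply/permP=> z; case: tpermP => [-> // | -> | /eqP ze /eqP zye].
  apply/eqP; have: y (y e) \in [:: y e, e, a, b, c & [:: d]] by rewrite T_eq.
  rewrite in_cons (negPf yye) in_cons /= => /orP[//|/fixed].
  by move/perm_inj=> yye'; rewrite yye' eqxx in yye.
apply: fixed; have: z \in [:: y e, e, a, b, c & [:: d]] by rewrite T_eq.
by rewrite 2!in_cons (negPf ze) (negPf zye).
Qed.

(** An involution [x] has a cycle [(a (x a))]; being even, it differs from this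
transposition, so it has a second cycle [(c (x c))]. The quotient of [x] by
both cycles is even and fixes four points. *)
Lemma Alt6_involution_tperm2 (T : finType) (x : {perm T}) :
    #|T| = 6 -> x \in 'Alt_T -> #[x] = 2 ->
  exists a b c d, uniq [:: a; b; c; d] /\ x = tperm a b * tperm c d.
Proof.
move=> T6 Ax ox; have evx := Ax; rewrite Alt_even in evx.
have xx z : x (x z) = z by rewrite -permM -expg2 -ox expg_order perm1.
have moved (s : {perm T}) : s != 1 -> exists z, s z != z.
  move=> s1; apply/existsP; apply: contraR s1; rewrite negb_exists.
  by move/forallP=> fix_s; apply/eqP/permP=> z; rewrite perm1; apply/eqP/negPn.
have [|a xa] := moved x.
  by apply/eqP=> x1; rewrite x1 order1 in ox.
have axa : a != x a by rewrite eq_sym.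
have [|c] := moved (tperm a (x a) * x).
  apply: contraL evx => /eqP/(canRL (mulKg _)) ->.
  by rewrite mulg1 odd_permV odd_tperm axa.
rewrite permM; case: tpermP => [->|->|/eqP ca /eqP cxa xc];
  rewrite ?xx ?eqxx //.
have cxc : c != x c by rewrite eq_sym.
have xca : x c != a by rewrite -[X in _ != X](xx a) (inj_eq perm_inj).
have xcxa : x c != x a by rewrite (inj_eq perm_inj).
have uabcd : uniq [:: a; x a; c; x c].
  rewrite /= !inE !negb_or axa cxc !(eq_sym _ c) !(eq_sym _ (x c)).
  by rewrite ca cxa xca xcxa.
exists a, (x a), c, (x c); split=> //; set t := tperm a _ * _.
have /(canRL (mulgK x)) -> : t * x = 1; last first.
  by apply/permP=> z; rewrite mul1g; apply: (@perm_inj _ x); rewrite xx permKV.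
have ta : t a = x a by rewrite permM tpermL tpermD.
have txa : t (x a) = a by rewrite permM tpermR tpermD.
have tc : t c = x c by rewrite permM [tperm a _ c]tpermD 1?eq_sym // tpermL.
have txc : t (x c) = c.
  by rewrite permM [tperm a _ (x c)]tpermD 1?eq_sym // tpermR.
apply: (Alt6_fix4_eq1 T6 _ uabcd); try by rewrite permM ?ta ?txa ?tc ?txc ?xx.
by rewrite Alt_even !odd_permM !odd_tperm axa cxc.
Qed.

Lemma tperm2_conj_Alt (T : finType) (a b c d a' b' c' d' : T) :
    #|T| = 6 -> uniq [:: a; b; c; d] -> uniq [:: a'; b'; c'; d'] ->
  exists2 g, g \in 'Alt_T &
    (tperm a b * tperm c d) ^ g = tperm a' b' * tperm c' d'.
Proof.
move=> T6 U U'; have := Alt_trans T; rewrite T6 => tr4.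
have dt (t : 4.-tuple T) : uniq t -> t \in 4.-dtuple([set: T]).
  by move=> Ut; rewrite inE Ut; apply/subsetP=> z; rewrite inE.
have [g Ag [-> -> -> ->]] :=
  atransP2 tr4 (dt [tuple a; b; c; d] U) (dt [tuple a'; b'; c'; d'] U').
by exists g; rewrite // conjMg !tpermJ.
Qed.

Lemma Alt6_involutions_conj (T : finType) (x y : {perm T}) :
    #|T| = 6 -> x \in 'Alt_T -> y \in 'Alt_T -> #[x] = 2 -> #[y] = 2 ->
  exists2 g, g \in 'Alt_T & x ^ g = y.
Proof.
move=> T6 Ax Ay /(Alt6_involution_tperm2 T6 Ax) [a [b [c [d [U ->]]]]].
move/(Alt6_involution_tperm2 T6 Ay) => [a' [b' [c' [d' [U' ->]]]]].
exact: tperm2_conj_Alt.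
Qed.

(** * Powers that fall into conjugates of a subgroup *)

(** A Sylow [p]-subgroup of [H] is one of [G] as well, because [p] does not
divide the index of [H]. *)
Lemma p_elt_conj_subgroup (gT : finGroupType) (G H : {group gT}) p x :
    H \subset G -> x \in G -> prime p -> p.-elt x -> ~~ (p %| #|G : H|) ->
  exists2 g, g \in G & x \in H :^ g.
Proof.
move=> sHG Gx pr_p px p'iHG; have [P sylP] := Sylow_exists p H.
have sylPG : p.-Sylow(G) P.
  have [sPH _ _] := and3P sylP.
  rewrite pHallE (subset_trans sPH sHG) /= (card_Hall sylP).
  by rewrite -(Lagrange sHG) partnM // [X in (_ * X)%N]part_p'nat ?muln1 ?p'natE.
have [|g Gg sxP] := Sylow_Jsub sylPG (Q := <[x]>) _ px.
  by rewrite cycle_subG.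
exists g^-1; rewrite ?groupV // mem_conjgV.
by rewrite (subsetP (pHall_sub sylP)) // (subsetP sxP) // memJ_conjg cycle_id.
Qed.

Theorem lemma5p3 : wexp_solvable 'Alt_('I_6)%G.
Proof.
move=> H sHG x Gx; set n := #|_ : H|.
have T6 := card_ord 6.
have trivial_case : #[x] %| n ->
    exists2 g, g \in 'Alt_('I_6) & x ^+ n \in H :^ g.
  by rewrite order_dvdn => /eqP->; exists 1; rewrite ?group1.
have Sylow_case p : prime p -> p.-elt x -> ~~ (p %| n) ->
    exists2 g, g \in 'Alt_('I_6) & x ^+ n \in H :^ g.
  move=> pr_p px p'n.
  have [g Gg Hx] := p_elt_conj_subgroup sHG Gx pr_p px p'n.
  by exists g; rewrite ?groupX.
have prime_case : prime #[x] ->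
    exists2 g, g \in 'Alt_('I_6) & x ^+ n \in H :^ g.
  move=> pr_x; have [/trivial_case // | ] := boolP (#[x] %| n).
  by apply: Sylow_case => //; apply: pnat_id.
have := Alt6_order_le5 T6 Gx; have := order_gt0 x.
case ox: #[x] => [|[|[|[|[|[|m]]]]]] // _ _;
  try by apply: prime_case; rewrite ox.
  by apply: trivial_case; rewrite ox dvd1n.
(* What remains is the order 4. *)
have [n4 | n'4] := boolP (4 %| n); first by apply: trivial_case; rewrite ox.
have [/dvdnP[m def_n] | n'2] := boolP (2 %| n); last first.
  by apply: Sylow_case n'2; rewrite // /p_elt ox.
have odd_m : odd m.
  by move: n'4; rewrite def_n (@dvdn_pmul2r 2 2 m isT) dvdn2 negbK.
have : 2 %| #|H|.
  have cardG : #|'Alt_('I_6)| = (2 ^ 2 * 90)%N.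
    by apply/eqP; rewrite -(eqn_pmul2l (_ : 0 < 2)) // card_Alt T6.
  have : 2 %| (#|H| * m)%N.
    by rewrite -(@dvdn_pmul2r 2 2 _ isT) -mulnA -def_n Lagrange // cardG dvdn_mulr.
  by rewrite Gauss_dvdl // coprime2n.
case/(Cauchy (isT : prime 2)) => y Hy oy.
have oxn : #[x ^+ n] = 2.
  have /eqP gcd2m : coprime 2 m by rewrite coprime2n.
  by rewrite orderXgcd ox def_n -(muln_gcdl 2 m 2) gcd2m.
have [g Gg <-] :=
  Alt6_involutions_conj T6 (subsetP sHG _ Hy) (groupX n Gx) oy oxn.
by exists g; rewrite ?memJ_conjg.
Qed.
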